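(* Let $\mathbb{F}=\mathbb{F}_2$, $m\ge1$ and $n\ge2$, and let $V=\mathbb{F}^n$. Then the following set is a minimal (with respect to inclusion) separating set for $\mathbb{F}[V^m]^{\mathcal{S}_n}$: $$S_{n,m}=\{\sigma_{2^r}(\underline{\alpha})\mid r\ge0,\ \underline{\alpha}=(\alpha_1,\ldots,\alpha_m),\ |\underline{\alpha}|\ge1,\ r+|\underline{\alpha}|-1\le\lfloor\log_2(n)\rfloor,\ \alpha_j\in\{0,1\}\text{ for }1\le j\le m\}.$$
   Context: $\mathbb{N}$ contains $0$. The symmetric group $\mathcal{S}_n$ acts on $V=\mathbb{F}^n$ by permuting coordinates and diagonally on $V^m=V\oplus\cdots\oplus V$. The coordinate ring is $\mathbb{F}[V^m]=\mathbb{F}[x(j)_i\mid 1\le i\le n,\ 1\le j\le m]$, where $x(j)_i$ is the $i$-th coordinate of the $j$-th vector, and $\sigma\cdot x(j)_i=x(j)_{\sigma(i)}$ for $\sigma\in\mathcal{S}_n$; $\mathbb{F}[V^m]^{\mathcal{S}_n}$ is the ring of invariant polynomials. For $\underline{\alpha}=(\alpha_1,\ldots,\alpha_m)\in\mathbb{N}^m$ put $|\underline{\alpha}|=\alpha_1+\cdots+\alpha_m$ and $x_i^{\underline{\alpha}}=x(1)_i^{\alpha_1}\cdots x(m)_i^{\alpha_m}$. For $1\le t\le n$, $$\sigma_t(\underline{\alpha})=\sum_{1\le i_1<\cdots<i_t\le n}x_{i_1}^{\underline{\alpha}}\cdots x_{i_t}^{\underline{\alpha}}\in\mathbb{F}[V^m]^{\mathcal{S}_n}.$$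 Elements $\underline{u},\underline{v}\in V^m$ are separated by a set $S$ of invariants if $f(\underline{u})\ne f(\underline{v})$ for some $f\in S$. A subset $S\subset\mathbb{F}[V^m]^{\mathcal{S}_n}$ is separating if any $\underline{u},\underline{v}\in V^m$ that can be separated by $\mathbb{F}[V^m]^{\mathcal{S}_n}$ can also be separated by $S$. *)

(* Defs.v *)
From mathcomp Require Import all_boot all_order all_fingroup all_algebra.
From mathcomp Require Import mpoly.

Set Implicit Arguments.
Unset Strict Implicit.
Unset Printing Implicit Defensive.

Import GRing.Theory.
Local Open Scope ring_scope.

(* A point of V^m, V = F^n, is a matrix 'M[F]_(m, n) whose j-th row is the    *)
(* j-th vector.  F[V^m] is {mpoly F[m * n]}, whose variables are numbered by  *)
(* the library's bijection mxvec_index : 'I_m -> 'I_n -> 'I_(m * n); indices  *)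
(* start at 0.                                                                *)
Section VectorInvariants.

Variables (F : fieldType) (m n : nat).

Local Notation coord_ring := {mpoly F[m * n]}.

Definition coord (j : 'I_m) (i : 'I_n) : coord_ring := 'X_(mxvec_index j i).

Definition eval_at (u : 'M[F]_(m, n)) (f : coord_ring) : F :=
  f.@[fun k => mxvec u 0 k].

Lemma eval_at_coord u j i : eval_at u (coord j i) = u j i.
Proof. by rewrite /eval_at /coord mevalXU mxvecE. Qed.

Definition coord_act (s : 'S_n) (f : coord_ring) : coord_ring :=
  f \mPo [tuple mxvec (\matrix_(j < m, i < n) coord j (s i)) 0 k | k < m * n].

Lemma coord_act_coord s j i : coord_act s (coord j i) = coord j (s i).
Proof. by rewrite /coord_act /coord comp_mpolyXU -tnth_nth tnth_mktuple mxvecE mxE. Qed.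

Definition invariant (f : coord_ring) : Prop :=
  forall s : 'S_n, coord_act s f = f.

Definition xmon (a : 'X_{1..m}) (i : 'I_n) : coord_ring :=
  \prod_(j < m) coord j i ^+ a j.

(* The indices i_1 < ... < i_t are encoded by the set they form.              *)
Definition sigma (t : nat) (a : 'X_{1..m}) : coord_ring :=
  \sum_(A : {set 'I_n} | #|A| == t) \prod_(i in A) xmon a i.

Definition separated_by (S : coord_ring -> Prop) (u v : 'M[F]_(m, n)) : Prop :=
  exists2 f, S f & eval_at u f <> eval_at v f.

Definition separating (S : coord_ring -> Prop) : Prop :=
  (forall f, S f -> invariant f) /\
  (forall u v, separated_by invariant u v -> separated_by S u v).

Definition minimal_separating (S : coord_ring -> Prop) : Prop :=
  separating S /\
  (forall T : coord_ring -> Prop,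
     (forall f, T f -> S f) -> separating T -> forall f, S f -> T f).

Definition S_set (f : coord_ring) : Prop :=
  exists (r : nat) (a : 'X_{1..m}),
    [/\ (1 <= mdeg a)%N,
        (r + mdeg a - 1 <= trunc_log 2 n)%N,
        forall j : 'I_m, a j \in [:: 0; 1]%N
      & f = sigma (2 ^ r) a].

End VectorInvariants.

(* Main.v *)
(* Identify a column of u with its support.  By Lucas, sigma_{2^r}(a) at u is *)
(* the r-th bit of the number N_A(u) of columns containing A = supp a.  If u  *)
(* and v are not in the same orbit, take a minimal A with N_A(u) <> N_A(v).   *)
(* By inclusion-exclusion all 2^|A| traces on A have multiplicities that      *)
(* differ by |N_A(u) - N_A(v)|, which is thus at most 2n / 2^|A|, and one of  *)
(* the bits r <= log2 n + 1 - |A| separates u from v.                         *)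

Require Import Defs.
From mathcomp Require Import all_boot all_order all_fingroup all_algebra.
From mathcomp Require Import mpoly.
From mathcomp Require Import zify.

Set Implicit Arguments.
Unset Strict Implicit.
Unset Printing Implicit Defensive.

Import GRing.Theory.

(** Separation. Up to permuting columns, a point over the field with two elements is a multiset of
    [n] subsets of ['I_m]. The counts N_B of columns containing B determine this multiset by
    inclusion-exclusion ([above_perm]), hence the orbit. The invariants in [S_set] give only the low
    binary digits of these counts, but at a minimal A where two points disagree, the gap is small
    enough for those digits to detect it ([above_dist_bound], [eqn_mod_pow2]).

    Minimality. For [sigma (2 ^ r) a] with support A, take one point whose nonzero columns come from
    the even subsets of A and one from the odd subsets, each subset repeated [2 ^ r] times. These
    fit into [n] columns because [2 ^ (r + #|A| - 1) <= n]. The counts N_B agree for B different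
    from A, while N_A is [2 ^ r] for one point and 0 for the other, so no other member of [S_set]
    separates the two ([card_parity_above], [S_set_minimal]). *)

(** * Binomial coefficients modulo 2 and binary digits *)

Lemma odd_bin_pow2 r j : 0 < j < 2 ^ r -> ~~ odd 'C(2 ^ r, j).
Proof.
case: j => [|j] // /andP[_ lt_j]; apply/negP => odd_bin.
have: 2 ^ r %| j.+1 * 'C(2 ^ r, j.+1) by rewrite -mul_bin_diag dvdn_mulr.
rewrite Gauss_dvdl; last by rewrite coprimeXl // coprime2n.
by move=> /dvdn_leq - /(_ isT); rewrite leqNgt lt_j.
Qed.

(** In Vandermonde's convolution only the two extreme terms survive modulo 2, by [odd_bin_pow2]. *)
Lemma odd_bin_addl r N : odd 'C(2 ^ r + N, 2 ^ r) = ~~ odd 'C(N, 2 ^ r).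
Proof.
have r_gt0 : 0 < 2 ^ r by rewrite expn_gt0.
rewrite -binomial.Vandermonde.
rewrite -(big_mkord xpredT (fun j => 'C(2 ^ r, j) * 'C(N, 2 ^ r - j))).
rewrite big_nat_recr // big_ltn //= !oddD subnn subn0 !bin0 binn !mul1n /=.
suff -> : odd (\sum_(1 <= j < 2 ^ r) 'C(2 ^ r, j) * 'C(N, 2 ^ r - j)) = false.
  by rewrite addbF addbT.
rewrite big_nat_cond; elim/big_ind: _ => // [x y|j].
  by rewrite oddD => -> ->.
by rewrite andbT oddM => /odd_bin_pow2/negbTE->.
Qed.

(* The case of Lucas' theorem at 2 in which the lower index is a power of 2. *)
Lemma odd_bin_bit r N : odd 'C(N, 2 ^ r) = odd (N %/ 2 ^ r).
Proof.
have r_gt0 : 0 < 2 ^ r by rewrite expn_gt0.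
elim/ltn_ind: N => N IH; case: (ltnP N (2 ^ r)) => [lt_N|le_N].
  by rewrite divn_small // bin_small.
rewrite -(subnKC le_N) odd_bin_addl IH; last by lia.
by rewrite divnDl // divnn r_gt0 oddD addTb.
Qed.

Lemma eqn_mod_pow2 k M N :
  (forall r, r < k -> odd (M %/ 2 ^ r) = odd (N %/ 2 ^ r)) -> M = N %[mod 2 ^ k].
Proof.
elim: k => [|k IH] bits; first by rewrite !modn1.
have /IH eq_mod : forall r, r < k -> odd (M %/ 2 ^ r) = odd (N %/ 2 ^ r).
  by move=> r lt_rk; apply: bits; lia.
have modS P : P %% 2 ^ k.+1 = odd (P %/ 2 ^ k) * 2 ^ k + P %% 2 ^ k.
  rewrite {1}(divn_eq P (2 ^ k)) {1}(divn_eq (P %/ 2 ^ k) 2) modn2 expnS.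
  rewrite mulnDl -mulnA -addnA modnMDl modn_small //.
  have := ltn_pmod P (expn_gt0 2 k : 0 < 2 ^ k); lia.
by rewrite !modS bits // eq_mod.
Qed.

Lemma leq_dist_eqn_mod d M N : M = N %[mod d] -> M != N -> d <= `|M - N|%N.
Proof.
wlog le_NM : M N / N <= M => [hw|].
  have [/hw//|/ltnW/hw hw'] := leqP N M.
  by move=> /esym/hw'; rewrite eq_sym distnC.
move=> /eqP; rewrite eqn_mod_dvd // distnEl // => /dvdn_leq le_d neq.
by apply: le_d; rewrite subn_gt0 ltn_neqAle eq_sym neq.
Qed.

(** * Even and odd subsets of a finite set *)

Section ParitySubsets.

Variable T : finType.
Implicit Types (A B C : {set T}) (e : bool).

Definition parity_subsets A e :=
  [set C : {set T} | (C \subset A) && (odd #|C| == e)].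

Definition toggle (j : T) C : {set T} := [set x | (x == j) (+) (x \in C)].

Lemma toggleK j : involutive (toggle j).
Proof. by move=> C; apply/setP => x; rewrite !inE addbA addbb. Qed.

Lemma odd_card_toggle j C : odd #|toggle j C| = ~~ odd #|C|.
Proof.
rewrite (cardsD1 j) [in RHS](cardsD1 j) !inE eqxx addTb.
have -> : toggle j C :\ j = C :\ j.
  by apply/setP => x; rewrite !inE; case: (x == j).
by rewrite !oddD; case: (j \in C); rewrite /= ?negbK.
Qed.

(** Toggling a fixed element of A outside B reverses parity and preserves both inclusions. *)
Lemma card_parity_above A B e : B \proper A ->
  #|[set C in parity_subsets A e | B \subset C]| =
  #|[set C in parity_subsets A (~~ e) | B \subset C]|.
Proof.
case/properP => sBA [j Aj nBj].
rewrite -!sum1dep_card [RHS](reindex_inj (inv_inj (toggleK j))) /=.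
apply: eq_bigl => C; rewrite !inE odd_card_toggle.
congr ((_ && _) && _).
- apply/subsetP/subsetP => sCA x; have := sCA x; rewrite !inE.
    by case: eqP => [->|].
  by case: eqP => [->|].
- by case: odd e => [] [].
- apply/subsetP/subsetP => sBC x Bx; have := sBC x Bx; rewrite !inE.
    by case: eqP nBj Bx => [-> /negbTE->|].
  by case: eqP nBj Bx => [-> /negbTE->|].
Qed.

Lemma card_parity_subsets A e : 0 < #|A| -> #|parity_subsets A e| = 2 ^ #|A|.-1.
Proof.
move=> A_gt0; have A_n0 : set0 \proper A by rewrite proper0 -card_gt0.
have aboveE e' :
    [set C : {set T} in parity_subsets A e' | set0 \subset C] =
    parity_subsets A e'.
  by apply/setP => C; rewrite !inE sub0set andbT.
have := card_parity_above e A_n0; rewrite !aboveE => eq_card.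
have : #|parity_subsets A e| + #|parity_subsets A (~~ e)| = 2 ^ #|A|.
  rewrite -card_powerset -(cardsID [set C : {set T} | odd #|C| == e] (powerset A)).
  congr addn; congr #|pred_of_set _|; apply/setP => C; rewrite !inE //.
  by rewrite andbC; congr andb; case: odd; case: (e).
rewrite -eq_card; case: #|A| A_gt0 => // k _; rewrite expnS /=; lia.
Qed.

End ParitySubsets.

(** * Inclusion-exclusion for families of sets *)

Section SetFamilies.

Variables (I T : finType).
Implicit Types (c : I -> {set T}) (A B G D : {set T}).

Definition above c B : nat := #|[set i | B \subset c i]|.

(** When G and D partition A, this is the number of indices with trace G on A. *)
Definition between c G D : nat :=
  #|[set i | (G \subset c i) && [disjoint D & c i]]|.

Lemma above0 c : above c set0 = #|I|.
Proof. by rewrite -cardsT; apply: eq_card => i; rewrite !inE sub0set. Qed.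

Lemma between0r c G : between c G set0 = above c G.
Proof.
apply: eq_card => i; rewrite !inE.
by rewrite -setI_eq0 set0I eqxx andbT.
Qed.

Lemma between_split c G D j :
  between c G D = between c (j |: G) D + between c G (j |: D).
Proof.
rewrite /between -(cardsID [set i | j \in c i]); congr addn; apply: eq_card => i.
  by rewrite !inE subUset sub1set andbC andbA.
by rewrite !inE -!setI_eq0 setIUl setU_eq0 !setI_eq0 disjoints1 andbCA.
Qed.

(** Removing elements from D one at a time with [between_split] reduces to values of [above] at
    subsets of [G :|: D], all proper in A. *)
Lemma between_proper_eq c1 c2 A G D :
    (forall B, B \proper A -> above c1 B = above c2 B) ->
    [disjoint G & D] -> G :|: D \proper A ->
  between c1 G D = between c2 G D.
Proof.
move=> eq_above.
elim: {D}_.+1 {-2}D (ltnSn #|D|) G => // k IH D leDk G disjGD prop.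
have [->|[j Dj]] := set_0Vmem D.
  rewrite !between0r; apply/eq_above/sub_proper_trans/prop; exact: subsetUl.
have eqD : j |: (D :\ j) = D by rewrite setD1K.
have Gj : j \notin G by rewrite (disjointFl disjGD).
have ltD : #|D :\ j| < k by move: leDk; rewrite (cardsD1 j D) Dj; lia.
have := between_split c1 G (D :\ j) j; rewrite eqD (IH (D :\ j)) //; first last.
- by apply: sub_proper_trans prop; rewrite setUS // subsetDl.
- by apply: disjointWr disjGD; rewrite subsetDl.
rewrite (IH (D :\ j) _ (j |: G)) //; first last.
- by rewrite -setUA setUCA eqD.
- rewrite -setI_eq0 setIUl setU_eq0 !setI_eq0 disjoints1 !inE eqxx /=.
  by apply: disjointWr disjGD; rewrite subsetDl.
have := between_split c2 G (D :\ j) j; rewrite eqD; lia.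
Qed.

(** Moving j from D to G changes the sign of the difference but not its size: the two counts add up
    to [between c G (D :\ j)], on which the families agree. Once D is empty, the count is [above] at
    A. *)
Lemma between_full_dist c1 c2 A G D :
    (forall B, B \proper A -> above c1 B = above c2 B) ->
    [disjoint G & D] -> G :|: D = A ->
  `|between c1 G D - between c2 G D|%N = `|above c1 A - above c2 A|%N.
Proof.
move=> eq_above.
elim: {D}_.+1 {-2}D (ltnSn #|D|) G => // k IH D leDk G disjGD eqA.
have [D0|[j Dj]] := set_0Vmem D.
  by rewrite -eqA D0 setU0 !between0r.
have eqD : j |: (D :\ j) = D by rewrite setD1K.
have Gj : j \notin G by rewrite (disjointFl disjGD).
have ltD : #|D :\ j| < k by move: leDk; rewrite (cardsD1 j D) Dj; lia.
have disjGD' : [disjoint G & D :\ j] by apply: disjointWr disjGD; rewrite subsetDl.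
have := between_split c1 G (D :\ j) j; rewrite eqD.
rewrite (between_proper_eq eq_above disjGD'); last first.
  rewrite properE -eqA setUS ?subsetDl //=; apply/subsetPn; exists j.
    by rewrite inE Dj orbT.
  by rewrite !inE eqxx (negbTE Gj).
have := between_split c2 G (D :\ j) j; rewrite eqD.
rewrite -(IH (D :\ j) _ (j |: G)) //; first lia.
- rewrite -setI_eq0 setIUl setU_eq0 !setI_eq0 disjoints1 !inE eqxx /=.
  by apply: disjointWr disjGD; rewrite subsetDl.
- by rewrite -setUA setUCA eqD.
Qed.

Lemma sum_between c A : \sum_(G in powerset A) between c G (A :\: G) = #|I|.
Proof.
rewrite -sum1_card (partition_big (fun i => c i :&: A) (mem (powerset A))) /=.
  apply: eq_bigr => G; rewrite inE => sGA.
  rewrite /between -sum1dep_card; apply: eq_bigl => i.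
  rewrite eqEsubset subsetI sGA andbT andbC; congr andb.
  by rewrite -setI_eq0 setIDAC setD_eq0 setIC.
by move=> i _; rewrite inE subsetIr.
Qed.

(* The 2 ^ #|A| classes of [I] cut out by the traces [c i :&: A] all have     *)
(* sizes that differ by the same amount between [c1] and [c2].                *)
Lemma above_dist_bound c1 c2 A :
    (forall B, B \proper A -> above c1 B = above c2 B) ->
  2 ^ #|A| * `|above c1 A - above c2 A|%N <= 2 * #|I|.
Proof.
move=> eq_above.
(* Both sides become sums over the traces G; termwise, the distance of two naturals is at most their
   sum. *)
rewrite -card_powerset -sum_nat_const mul2n -addnn.
rewrite -{1}(sum_between c1 A) -(sum_between c2 A) -big_split /=.
apply: leq_sum => G; rewrite inE => sGA.
rewrite -(between_full_dist eq_above (D := A :\: G) (G := G)).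
- lia.
- by rewrite -setI_eq0 setIDA setD_eq0 subsetIl.
- by rewrite -{1}(setIidPr sGA) setID.
Qed.

(** A fiber is a trace class on the full set, so [between_full_dist] applies with A the whole
    type. *)
Lemma card_fiber_above c1 c2 G :
    (forall B, above c1 B = above c2 B) ->
  #|[set i | c1 i == G]| = #|[set i | c2 i == G]|.
Proof.
move=> eq_above.
have fiberE c : #|[set i | c i == G]| = between c G (~: G).
  apply: eq_card => i; rewrite !inE eqEsubset andbC; congr andb.
  by rewrite -setI_eq0 setIC -setDE setD_eq0.
rewrite !fiberE.
have disj : [disjoint G & ~: G] by rewrite -setI_eq0 setICr.
have := between_full_dist (fun B _ => eq_above B) disj (setUCr G).
rewrite eq_above; lia.
Qed.

End SetFamilies.

Lemma above_perm n (T : finType) (c1 c2 : 'I_n -> {set T}) :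
    (forall B, above c1 B = above c2 B) ->
  exists s : 'S_n, forall i, c1 i = c2 (s i).
Proof.
move=> eq_above.
have /tuple_permP[s eq_s] :
    perm_eq [tuple c1 i | i < n] [tuple c2 i | i < n].
  apply/allP => G _ /=; apply/eqP.
  have countE (c : 'I_n -> {set T}) :
      count_mem G [seq c i | i <- enum 'I_n] = #|[set i | c i == G]|.
    rewrite -sum1_count big_map big_enum_cond -sum1dep_card.
    by apply: eq_bigl => i; rewrite inE.
  by rewrite !countE (card_fiber_above G eq_above).
exists s => i; rewrite -[RHS](tnth_mktuple c2) -(tnth_mktuple c1).
rewrite -[RHS](tnth_mktuple (fun i => tnth [tuple c2 i | i < n] (s i))).
by congr tnth; apply: val_inj.
Qed.

(** The padding value [set0] contains no nonempty B. *)
Lemma above_nth n (T : finType) (w : seq {set T}) B :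
    size w <= n -> B != set0 ->
  above (fun i : 'I_n => nth set0 w i) B = count [pred A : {set T} | B \subset A] w.
Proof.
move=> le_w B_n0.
rewrite /above -sum1dep_card -(big_mkord (fun i => B \subset nth set0 w i) (fun=> 1)).
rewrite (big_cat_nat (n := size w)) //= [X in _ + X]big1_seq ?addn0; last first.
  move=> i /andP[sB]; rewrite mem_index_iota => /andP[le_wi _]; move: sB.
  by rewrite nth_default // subset0 (negbTE B_n0).
by rewrite -(big_nth set0 (fun A => B \subset A) (fun=> 1)) sum1_count.
Qed.

Local Open Scope ring_scope.

(** * Invariance over an arbitrary field *)

Section Sigma.

Variables (F : fieldType) (m n : nat).
Implicit Types (a : 'X_{1..m}) (u v : 'M[F]_(m, n)) (s : 'S_n).

Lemma invariant_sigma t a : Defs.invariant (sigma F n t a).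
Proof.
move=> s; rewrite /coord_act /sigma rmorph_sum /=.
rewrite [RHS](reindex_inj (imset_inj (@perm_inj _ s))) /=.
apply: eq_big => [A|A _]; first by rewrite card_imset //; apply: perm_inj.
rewrite rmorph_prod big_imset /=; last by move=> i j _ _; apply: perm_inj.
apply: eq_bigr => i _; rewrite rmorph_prod; apply: eq_bigr => j _.
by rewrite rmorphXn /=; congr (_ ^+ _); apply: coord_act_coord.
Qed.

Lemma eval_invariant_perm f u v s :
    Defs.invariant f -> (forall j i, u j i = v j (s i)) ->
  eval_at u f = eval_at v f.
Proof.
move=> inv_f eq_uv; rewrite -[in RHS](inv_f s) /eval_at /coord_act comp_mpoly_meval.
apply: meval_eq => k; case/mxvec_indexP: k => j i.
by rewrite tnth_mktuple !mxvecE mxE eq_uv /Defs.coord mevalXU mxvecE.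
Qed.

End Sigma.

(** * Points over the field with two elements, and separation *)

Section PrimeField2.

Variables m n : nat.
Implicit Types (a : 'X_{1..m}) (u v : 'M['F_2]_(m, n)) (B : {set 'I_m}).

Definition column_supp u (i : 'I_n) : {set 'I_m} := [set j | u j i == 1].

Definition mnm_supp a : {set 'I_m} := [set j | a j != 0%N].

Definition mnm_set B : 'X_{1..m} := [multinom nat_of_bool (j \in B) | j < m].

Lemma mnm_supp_set B : mnm_supp (mnm_set B) = B.
Proof. by apply/setP => j; rewrite inE mnmE eqb0 negbK. Qed.

Lemma mdeg_set B : mdeg (mnm_set B) = #|B|.
Proof.
rewrite mdegE -sum1_card [RHS]big_mkcond /=; apply: eq_bigr => j _.
by rewrite mnmE; case: (j \in B).
Qed.

Lemma mnm_set_supp a : (forall j, a j \in [:: 0; 1]%N) -> mnm_set (mnm_supp a) = a.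
Proof.
move=> a01; apply/mnmP => j; rewrite mnmE inE.
by have := a01 j; rewrite !inE => /orP[]/eqP->.
Qed.

Lemma F2_cases (x : 'F_2) : x = (x == 1)%:R.
Proof. by case: x => [[|[|]]] // ?; apply: val_inj. Qed.

Lemma natr_F2_eq p q : (p%:R = q%:R :> 'F_2) <-> odd p = odd q.
Proof.
have oddE r : odd r = (r%:R == 1 :> 'F_2).
  by rewrite -val_eqE /= val_Fp_nat // modn2; case: odd.
split=> [eq_pq|]; first by rewrite !oddE eq_pq.
by rewrite !oddE [in p%:R = _](F2_cases p%:R) [in _ = q%:R](F2_cases q%:R) => ->.
Qed.

Lemma eval_xmon u a i :
  eval_at u (xmon 'F_2 a i) = (mnm_supp a \subset column_supp u i)%:R.
Proof.
rewrite /eval_at rmorph_prod /=.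
have evalE j : (Defs.coord 'F_2 j i ^+ a j).@[fun k => mxvec u 0 k] = u j i ^+ a j.
  by rewrite rmorphXn /= -/(eval_at _ _) eval_at_coord.
under eq_bigr do rewrite evalE.
have [/subsetP sub|/subsetPn[j]] := boolP (mnm_supp a \subset column_supp u i).
  rewrite big1 // => j _; have := sub j; rewrite !inE.
  by case: eqP => [->|_ /(_ isT)/eqP->]; rewrite ?expr1n.
rewrite !inE => aj uj; rewrite (bigD1 j) //=.
by rewrite [u j i]F2_cases (negbTE uj) expr0n (negbTE aj) mul0r.
Qed.

(** A product over a set of columns is 1 exactly when all of them contain the support of [a], so the
    sum counts [t]-subsets of those columns. *)
Lemma eval_sigma u t a :
  eval_at u (sigma 'F_2 n t a) = 'C(above (column_supp u) (mnm_supp a), t)%:R.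
Proof.
rewrite -cards_draws -sum1dep_card natr_sum [RHS]big_mkcondl /=.
rewrite /sigma /eval_at rmorph_sum /=; apply: eq_bigr => A _.
rewrite rmorph_prod /=.
have [/subsetP sub|/subsetPn[i Ai]] := boolP (A \subset _).
  rewrite big1 // => i /sub; rewrite inE -/(eval_at _ _) eval_xmon => ->//.
by rewrite inE (bigD1 i) //= -/(eval_at _ _) eval_xmon => /negbTE->; rewrite mul0r.
Qed.

Lemma eval_sigma_pow2 u v r a :
  eval_at u (sigma 'F_2 n (2 ^ r) a) = eval_at v (sigma 'F_2 n (2 ^ r) a) <->
  odd (above (column_supp u) (mnm_supp a) %/ 2 ^ r) =
  odd (above (column_supp v) (mnm_supp a) %/ 2 ^ r).
Proof. by rewrite !eval_sigma natr_F2_eq !odd_bin_bit. Qed.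

Lemma S_set_separating : (1 <= n)%N -> separating (@S_set 'F_2 m n).
Proof.
move=> n_gt0; split=> [f [r [a [_ _ _ ->]]]|u v [f inv_f neq_f]].
  exact: invariant_sigma.
pose P B := above (column_supp u) B != above (column_supp v) B.
have [/forallP eq_above|/forallPn[B0]] := boolP [forall B, ~~ P B].
  have [s eq_s] : exists s : 'S_n, forall i, column_supp u i = column_supp v (s i).
    by apply: above_perm => B; apply/eqP; have := eq_above B; rewrite negbK.
  case: neq_f; apply: (eval_invariant_perm (s := s)) => // j i.
  rewrite [LHS]F2_cases [RHS]F2_cases.
  by have /setP/(_ j) := eq_s i; rewrite !inE => ->.
rewrite negbK => /(minset_exists (P := P))[A /minsetP[neqA minA] _].
have eq_above B : B \proper A -> above (column_supp u) B = above (column_supp v) B.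
  move=> ltBA; apply/eqP; apply: contraTT ltBA => PB.
  apply/negP => /andP[sBA] /negP; apply.
  by rewrite (minA B PB sBA).
(* The count at the empty set is always [n], so it cannot differ. *)
have A_gt0 : (0 < #|A|)%N.
  by rewrite card_gt0; apply: contraNneq neqA => ->; rewrite !above0.
have := above_dist_bound eq_above; rewrite card_ord => leA.
have [L [defL ltnL]] : exists L, L = trunc_log 2 n /\ (n < 2 ^ L.+1)%N.
  by exists (trunc_log 2 n); split; last exact: trunc_log_ltn.
(* The indices [r < k] are exactly those with [r + #|A| - 1 <= L]. *)
pose k := (L.+2 - #|A|)%N.
have [/forallP eq_bits|/forallPn[r neq_r]] := boolP [forall r : 'I_k,
    odd (above (column_supp u) A %/ 2 ^ r) == odd (above (column_supp v) A %/ 2 ^ r)].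
  have : above (column_supp u) A = above (column_supp v) A %[mod 2 ^ k].
    by apply: eqn_mod_pow2 => r ltr; apply/eqP: (eq_bits (Ordinal ltr)).
  move/leq_dist_eqn_mod/(_ neqA) => le_dist.
  (* If the first [k] bits agreed, the gap would be at least [2 ^ k], against the bound [2 * n]; but
     [#|A| + k >= L.+2]. *)
  have : (2 ^ #|A| * 2 ^ k < 2 * 2 ^ L.+1)%N by nia.
  by rewrite -expnS -expnD ltn_exp2l // /k -maxnE ltnNge leq_maxr.
exists (sigma 'F_2 n (2 ^ r) (mnm_set A)); last first.
  by move/eval_sigma_pow2; rewrite mnm_supp_set; apply/eqP.
exists (r : nat), (mnm_set A); split.
- by rewrite mdeg_set.
- by have := ltn_ord r; rewrite mdeg_set -defL /k; clear -A_gt0; lia.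
- by move=> j; rewrite mnmE; case: (j \in A).
- by [].
Qed.

(** * Minimality: pairs of points separated by a single invariant *)

Definition mx_of_columns (w : seq {set 'I_m}) : 'M['F_2]_(m, n) :=
  \matrix_(j, i) (j \in nth set0 w i)%:R.

Lemma column_supp_mx w i : column_supp (mx_of_columns w) i = nth set0 w i.
Proof. by apply/setP => j; rewrite inE mxE; case: (j \in _). Qed.

Lemma S_set_minimal (T : {mpoly 'F_2[m * n]} -> Prop) :
    (1 <= n)%N -> (forall f, T f -> S_set f) -> separating T ->
  forall f, @S_set 'F_2 m n f -> T f.
Proof.
move=> n_gt0 subT [_ sepT] _ [r [a [deg_a le_L a01 ->]]].
set A := mnm_supp a.
have cardA : mdeg a = #|A| by rewrite -(mnm_set_supp a01) mdeg_set.
(* The witnesses have as nonzero columns 2 ^ r copies of each subset of A of  *)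
(* one parity, so toggling an element of A outside B shows that they have     *)
(* equally many columns containing B, unless B = A.                           *)
pose w e := flatten (nseq (2 ^ r) (enum (parity_subsets A e))).
have countw e B : count [pred C : {set 'I_m} | B \subset C] (w e) =
    (2 ^ r * #|[set C in parity_subsets A e | B \subset C]|)%N.
  rewrite count_flatten map_nseq sumn_nseq mulnC; congr muln.
  by rewrite -sum1_count big_enum_cond -sum1dep_card.
(* The length is [2 ^ r * 2 ^ (#|A| - 1)], so the degree bound in [S_set] is just what makes the
   columns fit. *)
have size_w e : (size (w e) <= n)%N.
  have -> : size (w e) = count [pred C : {set 'I_m} | set0 \subset C] (w e).
    by rewrite -count_predT; apply: eq_count => C; rewrite /= sub0set.
  apply: leq_trans (trunc_logP (ltnSn 1) n_gt0).
  apply: leq_trans (leq_pexp2l (ltn0Sn 1) le_L).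
  have A_gt0 : (0 < #|A|)%N by rewrite -cardA.
  rewrite countw -addnBA // expnD leq_mul2l cardA.
  have -> : [set C : {set 'I_m} in parity_subsets A e | set0 \subset C] =
      parity_subsets A e.
    by apply/setP => C; rewrite !inE sub0set andbT.
  by rewrite card_parity_subsets // subn1 leqnn orbT.
pose u e := mx_of_columns (w e).
have aboveE e B : B != set0 -> above (column_supp (u e)) B =
    (2 ^ r * #|[set C in parity_subsets A e | B \subset C]|)%N.
  move=> B_n0; rewrite -countw -(above_nth (size_w e)) //.
  by apply: eq_card => i; rewrite !inE column_supp_mx.
have A_n0 : A != set0 by rewrite -card_gt0 -cardA.
(* The only subset of A containing A is A itself, and it has just one parity. *)
have aboveA e : above (column_supp (u e)) A = (2 ^ r * (odd #|A| == e))%N.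
  rewrite aboveE //; congr muln.
  rewrite (_ : finset _ = if odd #|A| == e then [set A] else set0).
    by case: eqP => _; rewrite ?cards1 ?cards0.
  apply/setP => C; rewrite !inE andbAC -eqEsubset.
  by case: eqVneq => [->|neqCA]; case: ifP; rewrite !inE ?eqxx ?(negbTE neqCA).
have pow_gt0 k : (0 < 2 ^ k)%N by rewrite expn_gt0.
have sepS : separated_by T (u true) (u false).
  apply: sepT; exists (sigma 'F_2 n (2 ^ r) a); first exact: invariant_sigma.
  by move/eval_sigma_pow2; rewrite -/A !aboveA !mulKn //; case: (odd #|A|).
have [f Tf] := sepS; have [r' [b [deg_b _ b01 def_f]]] := subT f Tf.
rewrite def_f in Tf *; rewrite eval_sigma_pow2; set B := mnm_supp b.
have B_n0 : B != set0 by rewrite -card_gt0 -mdeg_set mnm_set_supp.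
have [eqBA|neqBA] := eqVneq B A; last first.
  rewrite !aboveE //; case; congr (odd (_ * _ %/ _)).
  have [sBA|nsBA] := boolP (B \subset A).
    by apply: card_parity_above; rewrite properEneq neqBA.
  have empty e : [set C : {set 'I_m} in parity_subsets A e | B \subset C] = set0.
    apply/setP => C; rewrite !inE.
    by apply: contraNF nsBA => /andP[/andP[sCA _] /subset_trans]; apply.
  by rewrite !empty.
rewrite eqBA !aboveA => neq_bit.
(* The counts at A are [2 ^ r] and 0, which differ in bit [r] only. *)
have eq_r : r = r'.
  apply/eqP; apply: contra_notT neq_bit => neq_r.
  have even_bit k : odd (2 ^ r * nat_of_bool k %/ 2 ^ r') = false.
    case: k; last by rewrite muln0 div0n.
    rewrite muln1; case: (ltngtP r r') neq_r => // lt_r _.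
      by rewrite divn_small // ltn_exp2l.
    by rewrite -expnB 1?ltnW // oddX subn_eq0 leqNgt lt_r.
  by rewrite !even_bit.
by move: Tf; rewrite -eq_r -(mnm_set_supp b01) -/B eqBA (mnm_set_supp a01).
Qed.

End PrimeField2.

Theorem theorem4p8 (m n : nat) (hm : (1 <= m)%N) (hn : (2 <= n)%N) :
  minimal_separating (@S_set 'F_2 m n).
Proof.
have n_gt0 : (1 <= n)%N by apply: ltnW.
split; first exact: S_set_separating.
by move=> T subT sepT f Sf; apply: S_set_minimal sepT f Sf.
Qed.
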